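(* Let $p_X:\Omega_X\to\mathbb{R}$ be a probability distribution (density) on a domain $\Omega_X\subset\mathbb{R}$ with zero mean and unit variance, i.e. $\int_{\Omega_X} p_X(x)\,x\,dx=0$ and $\int_{\Omega_X} p_X(x)\,x^2\,dx=1$. Let $A$ be an $n\times n$ matrix with entries $a_{i,j}$. Then $$\operatorname{perm}(A)=\int_{\Omega_X^n} d^n\mathbf{x}\,\prod_{i=1}^n p_X(x_i)\,x_i\sum_{j=1}^n a_{i,j}x_j,$$ where $\Omega_X^n=\Omega_X\times\cdots\times\Omega_X$ ($n$ factors) and $d^n\mathbf{x}=dx_1\cdots dx_n$. Equivalently, $$\operatorname{perm}(A)=\Big\langle \prod_{i=1}^n x_i\sum_{j=1}^n a_{i,j}x_j\Big\rangle_{x_i\sim p_X},$$ the expectation over independent identically distributed random variables $x_1,\dots,x_n$ each drawn from $p_X$.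
   Context: The permanent of an $n\times n$ matrix $A=(a_{i,j})$ is $\operatorname{perm}(A)=\sum_{\sigma\in S_n}\prod_{i=1}^n a_{i,\sigma(i)}$, where $S_n$ is the symmetric group. The distribution $p_X$ may be a generalized density (e.g. $p_X(x)=\tfrac12\delta(x-1)+\tfrac12\delta(x+1)$ with $\delta$ the Dirac delta), with integrals against it understood as expectations.
   Formalization: The integrand is additionally assumed integrable over Omega_X^n against the product distribution, since zero mean and unit variance alone do not make the integral exist (e.g. n=2, a_11=a_21=1, other entries 0, infinite third absolute moment). *)

(* Defs.v *)
From HB Require Import structures.
From mathcomp Require Import all_boot all_order all_fingroup all_algebra.
From mathcomp Require Import complex.
From mathcomp Require Import all_classical all_reals all_analysis.

Set Implicit Arguments.
Unset Strict Implicit.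
Unset Printing Implicit Defensive.

Import Order.TTheory GRing.Theory Num.Theory.

Local Open Scope classical_set_scope.
Local Open Scope ring_scope.

Definition permanent (K : comNzRingType) (n : nat) (A : 'M[K]_n) : K :=
  \sum_(s : 'S_n) \prod_(i < n) A i (s i).

Section complex_integral.
Context d (T : measurableType d) (R : realType).
Variables (mu : {measure set T -> \bar R}) (D : set T) (f : T -> R[i]).

Definition cintegrable : Prop :=
  mu.-integrable D (fun x => (complex.Re (f x))%:E) /\
  mu.-integrable D (fun x => (complex.Im (f x))%:E).

(* [Rintegral] takes the junk value [fine] of an infinite integral when [f] is
   not integrable, so this is meaningful only under [cintegrable]. *)
Definition cintegral : R[i] :=
  Complex (Rintegral mu D (fun x => complex.Re (f x)))
          (Rintegral mu D (fun x => complex.Im (f x))).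

End complex_integral.

Definition cexpectation d (T : measurableType d) (R : realType)
    (P : probability T R) (f : T -> R[i]) : R[i] :=
  cintegral P setT f.

Section product_measure.
Context d (T : measurableType d) (R : realType).

Definition tuple_cons (n : nat) (x : T * n.-tuple T) : n.+1.-tuple T :=
  [tuple of x.1 :: x.2].

Lemma measurable_tuple_cons (n : nat) :
  measurable_fun [set: T * n.-tuple T] (@tuple_cons n).
Proof. exact: measurable_cons. Qed.

HB.instance Definition _ (n : nat) :=
  @isMeasurableFun.Build _ _ _ _ (@tuple_cons n) (@measurable_tuple_cons n).

(* The n-fold product p (x) ... (x) p on T^n: the law of x :: t for
   (x, t) ~ p (x) p^(n-1). *)
Fixpoint pow_prob (p : probability T R) (n : nat) :
    probability (n.-tuple T) R :=
  match n with
  | 0 => dirac [tuple]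
  | m.+1 => distribution (p \x pow_prob p m)%E (@tuple_cons m)
  end.

Definition cube (n : nat) (D : set T) : set (n.-tuple T) :=
  [set x | forall i, D (tnth x i)].

Lemma measurable_box (n : nat) (B : 'I_n -> set T) :
  (forall i, measurable (B i)) ->
  measurable [set x : n.-tuple T | forall i, B i (tnth x i)].
Proof.
move=> mB.
rewrite (_ : [set x | _] =
    \big[setI/setT]_(i < n) ((fun x : n.-tuple T => tnth x i) @^-1` B i)).
  apply: bigsetI_measurable => i _.
  rewrite -[X in measurable X]setTI.
  exact: measurable_tnth.
apply/seteqP; split => [x xB|x].
  by rewrite -bigcap_seq => i _; exact: xB.
rewrite -bigcap_seq => xB i.
by apply: (xB i); rewrite /= mem_index_enum.
Qed.

(* [pow_prob p n] takes the expected values on measurable boxes, which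
   characterise the product measure. *)
Lemma pow_prob_box (p : probability T R) (n : nat) (B : 'I_n -> set T) :
  (forall i, measurable (B i)) ->
  pow_prob p n [set x | forall i, B i (tnth x i)] = (\prod_(i < n) p (B i))%E.
Proof.
elim: n => [|n IHn] in B * => mB.
  by rewrite big_ord0 /= diracE mem_set//= => -[].
rewrite big_ord_recl -IHn; last by move=> i; exact: mB.
rewrite -product_measure1E; [|exact: mB|exact: (@measurable_box n (fun i => B (lift ord0 i)))].
rewrite /= /distribution /pushforward; congr (_ _).
apply/seteqP; split => [[x t] /= xtB|[x t] /= [xB tB] i].
  by split=> [|i]; [exact: (xtB ord0)|have := xtB (lift ord0 i); rewrite tnthS].
by case: (unliftP ord0 i) => [j ->|->]; rewrite ?tnthS//; exact: tB.
Qed.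

End product_measure.

(* Mutual independence: the product rule for every subfamily J. *)
Definition independent d (T : measurableType d) d' (T' : measurableType d')
    (R : realType) (P : probability T R) (I : finType)
    (X : I -> {RV P >-> T'}) : Prop :=
  forall (J : {set I}) (B : I -> set T'), (forall i, measurable (B i)) ->
    P (\bigcap_(i in [set` J]) (X i @^-1` B i)) =
    (\prod_(i in J) P (X i @^-1` B i))%E.

Definition iid d (T : measurableType d) d' (T' : measurableType d')
    (R : realType) (P : probability T R) (p : probability T' R) (I : finType)
    (X : I -> {RV P >-> T'}) : Prop :=
  independent X /\
  forall i (B : set T'), measurable B -> distribution P (X i) B = p B.

Definition perm_integrand (R : realType) (n : nat) (A : 'M[R[i]]_n)
    (x : 'I_n -> R) : R[i] :=
  \prod_(i < n) ((x i)%:C%C * \sum_(j < n) A i j * (x j)%:C%C).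

(* Main.v *)
Require Import Defs.
From HB Require Import structures.
From mathcomp Require Import all_boot all_order all_fingroup all_algebra.
From mathcomp Require Import complex.
From mathcomp Require Import all_classical all_reals all_analysis.
From mathcomp Require Import measurable_realfun lra.

Set Implicit Arguments.
Unset Strict Implicit.
Unset Printing Implicit Defensive.

Import Order.TTheory GRing.Theory Num.Theory.

Local Open Scope classical_set_scope.
Local Open Scope ring_scope.

(** Expanding the product over all maps [f] from ['I_n] to itself, the integrand
    is a sum of monomials [prod_k x_k ^ (1 + #|f^-1 k|)].  If [f] is a
    permutation, all exponents are [2] and the monomial has mean [1]; otherwise
    some [k] is not a value of [f], the exponent of [x_k] is [1], and the
    monomial formally has mean [0].

    Only the whole integrand is assumed integrable: higher moments of [p] may be
    infinite, so the monomials need not be integrable one by one.  Integrating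
    out one variable at a time, Fubini makes the integrand, for almost all
    values of the other variables, an integrable univariate polynomial; since a
    polynomial dominates its leading power at infinity, every power with a
    nonzero coefficient is then integrable.  Hence the inner integral is again a
    sum of monomials in the remaining variables, and integrable as a whole. *)

(** * Growth of a real polynomial at infinity *)

Lemma normX_le_poly (R : realFieldType) (q : {poly R}) : q != 0 ->
  exists C B : R, forall x, `|x| ^+ (size q).-1 <= C * `|q.[x]| + B.
Proof.
move=> q0; set d := (size q).-1.
have sq : size q = d.+1 by rewrite prednK// size_poly_gt0.
set a := `|q`_d|; set S := \sum_(i < d) `|q`_i|.
have a0 : 0 < a by rewrite normr_gt0 -/(lead_coef q) lead_coef_eq0.
have S0 : 0 <= S by apply: sumr_ge0.
have SVa : 0 <= 2 * S / a by apply: divr_ge0; lra.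
(* Beyond the threshold [1 + 2 * S / a] the lower terms add up to at most half of [a * |x| ^+ d], so
   [|q.[x]|] is at least the other half; below it [|x| ^+ d] is at most the constant. The summand
   [1] makes powers of [|x|] increase with the exponent there. *)
exists (2 / a), ((1 + 2 * S / a) ^+ d) => x.
have [xK|Kx] := leP `|x| (1 + 2 * S / a).
  apply: ler_wpDl; first by rewrite mulr_ge0// divr_ge0// ltW.
  by rewrite lerXn2r// nnegrE// addr_ge0.
apply: ler_wpDr; first by rewrite exprn_ge0// addr_ge0.
have x1 : 1 <= `|x| by lra.
rewrite mulrAC ler_pdivlMr// mulrC.
have low : `|\sum_(i < d) q`_i * x ^+ i| * 2 <= a * `|x| ^+ d.
  case: d @a @S {sq} a0 S0 SVa Kx => [|d] a S a0 S0 SVa Kx.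
    by rewrite big_ord0 normr0 mul0r mulr_ge0// ltW.
  have : `|\sum_(i < d.+1) q`_i * x ^+ i| <= S * `|x| ^+ d.
    rewrite (le_trans (ler_norm_sum _ _ _))// mulr_suml ler_sum// => i _.
    by rewrite normrM normrX ler_wpM2l// ler_weXn2l// -ltnS.
  have : 2 * S / a <= `|x| by lra.
  rewrite ler_pdivrMr// => Sa.
  have := ler_wpM2r (exprn_ge0 d (normr_ge0 x)) Sa.
  rewrite exprS; lra.
rewrite horner_coef sq big_ord_recr/=.
have := lerB_normD (q`_d * x ^+ d) (\sum_(i < d) q`_i * x ^+ i).
rewrite [_ + \sum_(_ < _) _]addrC normrM normrX -/a; lra.
Qed.

(** * Moments and integrals of univariate polynomials *)

Section moments.
Context {R : realType} (p : probability R R).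

(** Such a [k] is at most the degree, so [|x| ^+ k] is bounded by [1] or by the leading power, hence
    by an affine function of [|q.[x]|]; constants are integrable for a probability. *)
Lemma integrable_coef_power (q : {poly R}) (k : nat) :
  p.-integrable setT (fun x => (q.[x])%:E) -> q`_k != 0 ->
  p.-integrable setT (fun x => (x ^+ k)%:E).
Proof.
move=> iq qk0.
have q0 : q != 0 by apply: contraNneq qk0 => ->; rewrite coef0.
have kd : (k <= (size q).-1)%N.
  rewrite -ltnS prednK ?size_poly_gt0// ltnNge.
  by apply: contraNN qk0 => /leq_sizeP ->.
have [C [B CB]] := normX_le_poly q0.
apply: (@le_integrable _ _ _ p setT _ _
    (fun x => (`|C| * `|q.[x]| + (`|B| + 1))%:E)) => //.
- exact/measurable_EFinP/measurable_funX.
- move=> x _; rewrite lee_fin normrX [leRHS]ger0_norm; last first.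
    by rewrite addr_ge0// ?mulr_ge0// addr_ge0.
  have [x1|x1] := leP `|x| 1.
    have : `|x| ^+ k <= 1 by rewrite exprn_ile1.
    by have := normr_ge0 B; have := mulr_ge0 (normr_ge0 C) (normr_ge0 q.[x]); lra.
  apply: (@le_trans _ _ (`|x| ^+ (size q).-1)); first by rewrite ler_weXn2l// ltW.
  have := CB x; have := ler_norm B.
  by have := ler_wpM2r (normr_ge0 q.[x]) (ler_norm C); lra.
- under eq_fun do rewrite EFinD EFinM.
  apply: integrableD => //; last exact: finite_measure_integrable_cst.
  apply: integrableZl => //.
  by apply: eq_integrable (integrable_abse iq).
Qed.

(* Set to [0] when the moment does not exist. *)
Definition moment (k : nat) : R :=
  if `[< p.-integrable setT (fun x : R => (x ^+ k)%:E) >]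
  then Rintegral p setT (fun x => x ^+ k) else 0.

(** A power that is not integrable has coefficient [0], so the default value of [moment] never
    contributes. *)
Lemma integral_horner (q : {poly R}) (N : nat) : (size q <= N)%N ->
  p.-integrable setT (fun x => (q.[x])%:E) ->
  (\int[p]_x (q.[x])%:E = (\sum_(i < N) q`_i * moment i)%:E)%E.
Proof.
move=> qN iq.
have iqk (i : 'I_N) : p.-integrable setT (fun x => (q`_i * x ^+ i)%:E).
  have [->|qi] := eqVneq q`_i 0.
    by under eq_fun do rewrite mul0r; exact: integrable0.
  under eq_fun do rewrite EFinM.
  by apply: integrableZl => //; exact: integrable_coef_power qi.
under eq_integral do rewrite (horner_coef_wide _ qN) -sumEFin.
rewrite integral_sum// -sumEFin; apply: eq_bigr => i _.
have [->|qi] := eqVneq q`_i 0.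
  by under eq_integral do rewrite mul0r; rewrite mul0r integral0.
have ii := integrable_coef_power iq qi.
under eq_integral do rewrite EFinM.
rewrite integralZl// EFinM /moment asboolT//.
by rewrite /Rintegral fineK// integrable_fin_num.
Qed.

(** Terms sharing an exponent may cancel, and then that power need not be integrable. Collecting the
    terms into a polynomial leaves only the total coefficient of each power to consider. *)
Lemma integral_sum_powers (I : finType) (c : I -> R) (m : I -> nat) :
  p.-integrable setT (fun x => (\sum_t c t * x ^+ m t)%:E) ->
  (\int[p]_x (\sum_t c t * x ^+ m t)%:E = (\sum_t c t * moment (m t))%:E)%E.
Proof.
pose q := \sum_t c t *: 'X^(m t).
have qE x : \sum_t c t * x ^+ m t = q.[x].
  by rewrite horner_sum; apply: eq_bigr => t _; rewrite hornerZ hornerXn.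
have -> : (fun x => (\sum_t c t * x ^+ m t)%:E) = (fun x => (q.[x])%:E).
  by apply/funext => x; rewrite qE.
move=> iq; set N := maxn (size q) (\max_t (m t).+1).
rewrite (integral_horner (leq_maxl _ _ : (_ <= N)%N) iq); congr EFin.
under eq_bigr do rewrite coef_sum mulr_suml.
rewrite exchange_big; apply: eq_bigr => t _ /=.
have mN : (m t < N)%N by rewrite leq_max leq_bigmax orbT.
rewrite (bigD1 (Ordinal mN))//= big1 ?addr0 => [|i /eqP it].
  by rewrite coefZ coefXn eqxx mulr1.
rewrite coefZ coefXn; case: eqVneq => [im|]; last by rewrite mulr0 mul0r.
by case: it; exact: val_inj.
Qed.

End moments.

(** * Sums of monomials under the product measure *)

Lemma integrable_distribution d d' (T : measurableType d)
    (T' : measurableType d') (R : realType) (P : probability T R)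
    (X : {RV P >-> T'}) (f : T' -> \bar R) :
  (distribution P X).-integrable setT f -> P.-integrable setT (f \o X).
Proof.
move=> /integrableP[mf fi]; apply/integrableP; split.
  exact: measurableT_comp.
move: fi; rewrite ge0_integral_distribution//; exact: measurableT_comp.
Qed.

Lemma measurable_sum_monomials (R : realType) (n : nat) (I : finType)
    (c : I -> R) (m : I -> 'I_n -> nat) :
  measurable_fun setT (fun x : n.-tuple R =>
    (\sum_t c t * \prod_(k < n) tnth x k ^+ m t k)%:E).
Proof.
apply/measurable_EFinP; apply: measurable_sum => t; apply: measurable_funM => //.
apply: measurable_prod => k _; apply: measurable_funX.
exact: measurable_tnth.
Qed.

(** Induction on [n], integrating out the head variable: the index type stays, and [c t] is
    multiplied by the moment of the head exponent. The alternative [c t = 0] keeps the hypothesis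
    inductive: when the head exponent is [1], the new coefficient vanishes and nothing is known
    about the other exponents. *)
Lemma integral_sum_monomials (R : realType) (p : probability R R)
    (m1 : moment p 1 = 0) (m2 : moment p 2 = 1)
    (n : nat) (I : finType) (c : I -> R) (m : I -> 'I_n -> nat) :
  (forall t, [\/ c t = 0, forall k, m t k = 2 | exists k, m t k = 1]) ->
  (pow_prob p n).-integrable setT
    (fun x => (\sum_t c t * \prod_(k < n) tnth x k ^+ m t k)%:E) ->
  (\int[pow_prob p n]_x (\sum_t c t * \prod_(k < n) tnth x k ^+ m t k)%:E =
   (\sum_(t | [forall k, m t k == 2]) c t)%:E)%E.
Proof.
elim: n I c m => [|n IHn] I c m cm.
  move=> _; rewrite integral_dirac//; last first.
    exact: measurable_sum_monomials.
  rewrite diracT mul1e; congr EFin.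
  under eq_bigr do rewrite big_ord0 mulr1.
  by apply: eq_bigl => t; apply/esym/forallP => -[].
set f := (X in _.-integrable _ X).
move=> /integrable_distribution idf.
have intf : (p \x pow_prob p n)%E.-integrable setT (f \o @tuple_cons _ R n) := idf.
have mf : measurable_fun setT f by exact: measurable_sum_monomials.
rewrite integral_distribution//.
have fE x y : (f \o @tuple_cons _ R n) (x, y) = (\sum_t
    (c t * \prod_(k < n) tnth y k ^+ m t (lift ord0 k)) * x ^+ m t ord0)%:E.
  rewrite /f/=; congr EFin; apply: eq_bigr => t _.
  rewrite big_ord_recl mulrAC -mulrA; congr (_ * (_ * _)).
  by apply: eq_bigr => k _; rewrite tnthS.
rewrite -(integral21_prod_meas1 intf).
set g := fun y : n.-tuple R => (\sum_t (c t * moment p (m t ord0)) *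
  \prod_(k < n) tnth y k ^+ m t (lift ord0 k))%:E.
have mg : measurable_fun setT g by exact: measurable_sum_monomials.
(* By Fubini the section at [y] is integrable only for almost every [y], hence equality almost
   everywhere. *)
have aeg : ae_eq (pow_prob p n) setT (fubini_G p (f \o @tuple_cons _ R n)) g.
  apply: filterS (ae_integrable2 intf) => y iy _.
  move: iy; rewrite /fubini_G (funext (fE ^~ y)) => iy.
  rewrite integral_sum_powers// /g; congr EFin; apply: eq_bigr => t _.
  by rewrite mulrAC.
have mG := measurable_fubini_G intf.
rewrite (ae_eq_integral g)//.
rewrite [LHS]IHn.
- congr EFin; rewrite big_mkcond [RHS]big_mkcond; apply: eq_bigr => t _.
  case: ifPn => [/forallP/= m2'|m2']; case: ifPn => [/forallP m2''|m2'']//.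
  + by rewrite (eqP (m2'' ord0)) m2 mulr1.
  (* All tail exponents are [2] but the head one is not: either [c t = 0], or the head exponent is
     [1] and [m1] kills the term. *)
  + case: (cm t) => [->|mt2|[k mk]]; first by rewrite mul0r.
      by case/negP: m2''; apply/forallP => k; rewrite mt2.
    case: (unliftP ord0 k) mk => [j ->|->] mk; last by rewrite mk m1 mulr0.
    by have := m2' j; rewrite mk.
  + by case/negP: m2'; apply/forallP.
- move=> t; case: (cm t) => [->|mt2|[k mk]].
  + by constructor 1; rewrite mul0r.
  + by constructor 2 => k.
  + case: (unliftP ord0 k) mk => [j ->|->] mk; last first.
      by constructor 1; rewrite mk m1 mulr0.
    by constructor 3; exists j.
(* Almost everywhere [g] is the inner integral, whose absolute value is at most the inner integral
   of the absolute value; the latter has finite integral by Tonelli. *)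
- apply/integrableP; split => //.
  have mfc := measurable_int _ intf.
  apply: le_lt_trans ((integrable21ltyP _ _ mfc).1 intf).
  rewrite (ae_eq_integral (fun y => `|fubini_G p (f \o @tuple_cons _ R n) y|)%E)//.
  + apply: ge0_le_integral => //.
    * exact: measurableT_comp.
    * apply: (measurable_fun_fubini_tonelli_G (abse \o (f \o @tuple_cons _ R n))).
      - exact: measurableT_comp.
      - by move=> z; exact: abse_ge0.
    * move=> y _; apply: le_abse_integral => //.
      exact: measurableT_comp.
  + exact: measurableT_comp.
  + exact: measurableT_comp.
  + by apply: filterS aeg => y /= /[apply] ->.
Qed.

(** * Uniqueness of the product measure; joint law of an iid family *)

Section pow_prob_unique.
Context d (T : measurableType d) (R : realType).

(** Boxes are closed under intersection, as the uniqueness theorem for measures requires. They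
    generate because a one-coordinate preimage is a box whose other sides are full. *)
Lemma measurable_tuple_boxes (n : nat) :
  @measurable _ (n.-tuple T) = <<s [set [set x : n.-tuple T |
    forall i, B i (tnth x i)] | B in [set B : 'I_n -> set T | forall i, measurable (B i)] ] >>.
Proof.
apply/seteqP; split; last first.
  apply: smallest_sub; first exact: sigma_algebra_measurable.
  by move=> _ [B mB <-]; exact: measurable_box.
apply: smallest_sub; first exact: smallest_sigma_algebra.
rewrite -bigcup_seq => A [i _ [B mB <-]]; apply: sub_sigma_algebra => /=.
exists (fun j => if j == i then B else setT).
  by move=> j; case: ifP.
apply/seteqP; split=> [x /(_ i)|x [_ Bx] j]; first by rewrite eqxx.
by case: eqP => [->|].
Qed.

Lemma pow_prob_unique (p : probability T R) (n : nat)
    (mu : probability (n.-tuple T) R) :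
  (forall B : 'I_n -> set T, (forall i, measurable (B i)) ->
    mu [set x | forall i, B i (tnth x i)] = (\prod_(i < n) p (B i))%E) ->
  forall A, measurable A -> mu A = pow_prob p n A.
Proof.
move=> muE A mA.
apply: (measure_unique _ (fun=> setT) (measurable_tuple_boxes n)) => //.
- move=> _ _ [B mB <-] [C mC <-]; exists (fun i => B i `&` C i).
    by move=> i; exact: measurableI.
  by apply/seteqP; split=> [x BC|x [Bx Cx] i]; [split=> i; case: (BC i)|split].
- by move=> _; exists (fun=> setT) => //; apply/seteqP; split.
- by rewrite bigcup_const.
- by move=> _ [B mB <-]; exact: etrans (muE _ mB) (esym (pow_prob_box _ mB)).
- by move=> _; rewrite ltey_eq fin_num_measure.
Qed.

Lemma iid_pow_prob d' (T' : measurableType d') (P : probability T' R)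
    (p : probability T R) (n : nat) (X : 'I_n -> {RV P >-> T}) :
  iid p X -> exists Y : {RV P >-> n.-tuple T},
    (forall t, tnth (Y t) = X ^~ t) /\
    (forall A, measurable A -> distribution P Y A = pow_prob p n A).
Proof.
move=> [indX lawX].
pose Y t := [tuple X i t | i < n].
have mY : measurable_fun setT Y.
  apply/measurable_fun_tnthP => i.
  rewrite (_ : _ \o _ = X i)//; by apply/funext => t /=; rewrite tnth_mktuple.
pose Y' : {RV P >-> n.-tuple T} := HB.pack Y (@isMeasurableFun.Build _ _ _ _ Y mY).
exists Y'; split; first by move=> t; apply/funext => i; rewrite tnth_mktuple.
apply: pow_prob_unique => B mB.
rewrite /distribution /pushforward/=.
have lawX' i : P (X i @^-1` B i) = p (B i) by exact: lawX.
(* Independence at the full index set is the product rule on boxes. *)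
have := indX [set: 'I_n]%SET B mB.
under [in RHS]eq_bigr do rewrite lawX'.
rewrite (_ : \bigcap_(i in _) _ = Y @^-1` [set x | forall i, B i (tnth x i)]).
  by move=> PY; apply: etrans PY _; apply: eq_bigl => i; rewrite inE.
apply/seteqP; split=> [t BX i|t BX i _]; last by have := BX i; rewrite tnth_mktuple.
by rewrite tnth_mktuple; apply: BX; rewrite /= inE.
Qed.

End pow_prob_unique.

(** * Passing between an event of probability one and the whole space *)

Section full_measure.
Context d (T : measurableType d) (R : realType) (P : probability T R).
Variables (D : set T) (f : T -> \bar R).
Hypotheses (mD : measurable D) (PD : P D = 1%E) (mf : measurable_fun setT f).

Let PC : P (~` D) = 0%E.
Proof. by rewrite probability_setC// PD subee. Qed.

Lemma integrable_full_measure : P.-integrable setT f <-> P.-integrable D f.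
Proof.
have := @negligible_integrable _ _ _ P setT (~` D) f.
by rewrite setTD setCK; apply => //; exact: measurableC.
Qed.

Lemma integral_full_measure : P.-integrable setT f ->
  (\int[P]_x f x = \int[P]_(x in D) f x)%E.
Proof.
move=> fi; rewrite (negligible_integral (measurableC mD))//.
by rewrite setTD setCK.
Qed.

End full_measure.

(** * First and second moments of [p] *)

Section standardized_moments.
Context (R : realType) (p : probability R R) (Omega : set R).
Hypotheses (mOmega : measurable Omega) (pOmega : p Omega = 1%E).
Hypothesis var1 : (\int[p]_(x in Omega) (x ^+ 2)%:E)%E = 1%E.

Let mX k : measurable_fun [set: R] (fun x : R => (x ^+ k)%:E).
Proof. by apply/measurable_EFinP; exact: measurable_funX. Qed.

(** The integrand is nonnegative, so the finite value in [var1] certifies integrability. *)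
Let intX2 : p.-integrable setT (fun x : R => (x ^+ 2)%:E).
Proof.
apply/(integrable_full_measure mOmega) => //.
apply/integrableP; split; first exact: measurable_funTS.
under eq_integral do rewrite gee0_abs ?lee_fin ?sqr_ge0//.
by rewrite var1 ltry.
Qed.

Let intX1 : p.-integrable setT (fun x : R => (x ^+ 1)%:E).
Proof.
apply: (@le_integrable _ _ _ p setT _ _ (fun x => (1 + x ^+ 2)%:E)) => //.
- by move=> x _; rewrite lee_fin ler_norml; have := ler_norm (1 + x ^+ 2); nra.
- under eq_fun do rewrite EFinD.
  by apply: integrableD => //; exact: finite_measure_integrable_cst.
Qed.

Lemma moment2 : moment p 2 = 1.
Proof.
rewrite /moment asboolT// /Rintegral (integral_full_measure mOmega)//.
by rewrite var1.
Qed.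

Lemma moment1 : (\int[p]_(x in Omega) x%:E)%E = 0%E -> moment p 1 = 0.
Proof.
move=> mean0; rewrite /moment asboolT// /Rintegral (integral_full_measure mOmega)//.
by under eq_integral do rewrite expr1; rewrite mean0.
Qed.

End standardized_moments.

(** * Exponents attached to a self-map of the index set *)

Definition fiber_exponent (n : nat) (f : {ffun 'I_n -> 'I_n}) (k : 'I_n) : nat :=
  (#|[set i | f i == k]%SET|).+1.

(** Grouping the factors [x (f i)] by value gives [x k] once per point of its fiber; the separate
    factor [x k] accounts for the successor in [fiber_exponent]. *)
Lemma prod_fiber_exponent (R : comNzRingType) (n : nat)
    (f : {ffun 'I_n -> 'I_n}) (x : 'I_n -> R) :
  \prod_(i < n) (x i * x (f i)) = \prod_(k < n) x k ^+ fiber_exponent f k.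
Proof.
rewrite big_split/= [X in _ * X](partition_big f xpredT)//= -big_split/=.
apply: eq_bigr => k _; rewrite exprS; congr (_ * _).
under eq_bigr => i /eqP -> do [].
by rewrite prodr_const cardsE.
Qed.

(** Exponent [2] means a one-point fiber; an injective self-map of a finite set is bijective, so no
    fiber is empty. *)
Lemma fiber_exponent2 (n : nat) (f : {ffun 'I_n -> 'I_n}) :
  injectiveb f = [forall k, fiber_exponent f k == 2].
Proof.
apply/injectiveP/forallP => [fI k|f2 i j fij].
  have [g _ gK] := injF_bij fI.
  rewrite eqSS (_ : [set i | _]%SET = [set g k]%SET) ?cards1//.
  by apply/setP => i; rewrite !inE -(inj_eq fI) gK.
have /eqP := f2 (f j); rewrite /fiber_exponent => -[/eqP/cards1P[k E]].
have : i \in [set i | f i == f j]%SET by rewrite inE fij.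
have : j \in [set i | f i == f j]%SET by rewrite inE.
by rewrite E !inE => /eqP -> /eqP ->.
Qed.

Lemma fiber_exponent1 (n : nat) (f : {ffun 'I_n -> 'I_n}) :
  ~~ injectiveb f -> exists k, fiber_exponent f k = 1.
Proof.
move=> fNI; apply: contrapT => no1.
have surj k : exists i, f i == k.
  apply: contrapT => Nk; apply: no1; exists k; congr S; apply/eqP.
  rewrite cards_eq0; apply/eqP/setP => i; rewrite !inE.
  by apply/negP => fik; apply: Nk; exists i.
case/negP: fNI; apply/injectiveP.
(* Without empty fibers, a choice of preimages is injective, hence bijective by finiteness, and [f]
   is its inverse. *)
have gK : cancel (fun k => xchoose (surj k)) f.
  by move=> k; apply/eqP; exact: (xchooseP (surj k)).
exact: (bij_inj (bij_can_bij (injF_bij (can_inj gK)) gK)).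
Qed.

(** * Integrand and permanent as sums over self-maps *)

Section expansion.
Context (R : realType) (n : nat) (A : 'M[R[i]]_n).

Lemma perm_integrandE (x : 'I_n -> R) : perm_integrand A x =
  \sum_(f : {ffun 'I_n -> 'I_n})
    (\prod_(i < n) A i (f i)) * (\prod_(k < n) x k ^+ fiber_exponent f k)%:C%C.
Proof.
rewrite /perm_integrand.
under eq_bigr do rewrite mulr_sumr.
rewrite bigA_distr_bigA/=; apply: eq_bigr => f _.
rewrite -prod_fiber_exponent rmorph_prod -big_split/=.
by apply: eq_bigr => i _; rewrite rmorphM/= mulrCA.
Qed.

Lemma permanentE : permanent A =
  \sum_(f : {ffun 'I_n -> 'I_n} | injectiveb f) \prod_(i < n) A i (f i).
Proof.
rewrite (reindex (@pval _))/=; last first.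
  (* Permutations are the injective finite functions; the identity is only a default value off that
     set. *)
  by exists (insubd (1%g : 'S_n)) => /= f Uf; first apply: val_inj; apply: insubdK.
apply: eq_big => [s|s _]; first by rewrite (valP s).
by apply: eq_bigr => i _; rewrite pvalE.
Qed.

(** The monomials are real, so the real part acts on the coefficients alone and real integration
    applies. *)
Lemma Re_perm_integrand (x : 'I_n -> R) : complex.Re (perm_integrand A x) =
  \sum_(f : {ffun 'I_n -> 'I_n})
    complex.Re (\prod_(i < n) A i (f i)) * \prod_(k < n) x k ^+ fiber_exponent f k.
Proof.
rewrite perm_integrandE raddf_sum; apply: eq_bigr => f _.
by case: (\prod_(i < n) A i (f i)) => a b /=; rewrite mulr0 subr0.
Qed.

Lemma Im_perm_integrand (x : 'I_n -> R) : complex.Im (perm_integrand A x) =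
  \sum_(f : {ffun 'I_n -> 'I_n})
    complex.Im (\prod_(i < n) A i (f i)) * \prod_(k < n) x k ^+ fiber_exponent f k.
Proof.
rewrite perm_integrandE raddf_sum; apply: eq_bigr => f _.
by case: (\prod_(i < n) A i (f i)) => a b /=; rewrite mulr0 add0r.
Qed.

End expansion.

(** * Evaluation of the integral and of the expectation *)

Lemma integral_fiber_sum (R : realType) (p : probability R R)
    (m1 : moment p 1 = 0) (m2 : moment p 2 = 1)
    (n : nat) (c : {ffun 'I_n -> 'I_n} -> R) :
  (pow_prob p n).-integrable setT
    (fun x => (\sum_f c f * \prod_(k < n) tnth x k ^+ fiber_exponent f k)%:E) ->
  (\int[pow_prob p n]_x
     (\sum_f c f * \prod_(k < n) tnth x k ^+ fiber_exponent f k)%:E =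
   (\sum_(f : {ffun 'I_n -> 'I_n} | injectiveb f) c f)%:E)%E.
Proof.
move=> ci; rewrite integral_sum_monomials//.
  by under eq_bigl do rewrite -fiber_exponent2.
move=> f; have [|/fiber_exponent1] := boolP (injectiveb f); last by constructor 3.
by rewrite fiber_exponent2 => /forallP f2; constructor 2 => k; apply/eqP.
Qed.

(** The variables form a random tuple of law [pow_prob p n], and a change of variables reduces the
    expectation to the integral over tuples. *)
Lemma expectation_fiber_sum (R : realType) (p : probability R R)
    (m1 : moment p 1 = 0) (m2 : moment p 2 = 1)
    (n : nat) (c : {ffun 'I_n -> 'I_n} -> R)
    d (T : measurableType d) (P : probability T R) (X : 'I_n -> {RV P >-> R}) :
  (pow_prob p n).-integrable setT
    (fun x => (\sum_f c f * \prod_(k < n) tnth x k ^+ fiber_exponent f k)%:E) ->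
  iid p X ->
  (\int[P]_t (\sum_f c f * \prod_(k < n) X k t ^+ fiber_exponent f k)%:E =
   (\sum_(f : {ffun 'I_n -> 'I_n} | injectiveb f) c f)%:E)%E.
Proof.
set F := (X in _.-integrable _ X) => iF /iid_pow_prob[Y [YX YE]].
have mF : measurable_fun setT F by exact: measurable_sum_monomials.
have iFY : (distribution P Y).-integrable setT F.
  apply/integrableP; split => //.
  rewrite (eq_measure_integral (pow_prob p n)); last by move=> B mB _; exact: YE.
  by case/integrableP : iF.
have := integral_distribution mF (integrable_distribution iFY).
rewrite (eq_measure_integral (pow_prob p n)); last by move=> B mB _; exact: YE.
rewrite integral_fiber_sum// => ->.
by apply: eq_integral => t _; rewrite /F/= YX.
Qed.

Lemma pow_prob_cube d (T : measurableType d) (R : realType)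
    (p : probability T R) (n : nat) (D : set T) :
  measurable D -> p D = 1%E -> pow_prob p n (cube D) = 1%E.
Proof.
move=> mD pD; apply: etrans (pow_prob_box p (fun _ : 'I_n => mD)) _.
by rewrite big1.
Qed.

Theorem theorem1 (R : realType) (Omega : set R)
    (p : probability R R)
    (mOmega : measurable Omega) (pOmega : p Omega = 1%E)
    (mean0 : (\int[p]_(x in Omega) x%:E)%E = 0%E)
    (var1 : (\int[p]_(x in Omega) (x ^+ 2)%:E)%E = 1%E)
    (n : nat) (A : 'M[R[i]]_n)
    (intA : cintegrable (pow_prob p n) (cube Omega)
              (fun x => perm_integrand A (tnth x))) :
  permanent A = cintegral (pow_prob p n) (cube Omega)
             (fun x => perm_integrand A (tnth x))
  /\
  (forall (d : measure_display) (T : measurableType d) (P : probability T R)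
      (X : 'I_n -> {RV P >-> R}),
    iid p X ->
    permanent A = cexpectation P (fun t => perm_integrand A (fun i => X i t))).
Proof.
have m1 := moment1 mOmega pOmega var1 mean0.
have m2 := moment2 mOmega pOmega var1.
have mc := measurable_box (fun _ : 'I_n => mOmega).
have pc := pow_prob_cube n mOmega pOmega.
(* The cube has probability one, so integrability and integral carry over to all tuples, where the
   evaluations are stated. *)
have full c (F := fun x : n.-tuple R =>
      (\sum_f c f * \prod_(k < n) tnth x k ^+ fiber_exponent f k)%:E) :
    (pow_prob p n).-integrable (cube Omega) F ->
    (pow_prob p n).-integrable setT F /\
    (\int[pow_prob p n]_x F x = \int[pow_prob p n]_(x in cube Omega) F x)%E.
  have mF : measurable_fun setT F by exact: measurable_sum_monomials.
  move=> /(integrable_full_measure mc pc mF) iF; split => //.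
  exact: (integral_full_measure mc pc).
case: intA.
rewrite (funext (fun x => congr1 EFin (Re_perm_integrand A (tnth x)))).
rewrite (funext (fun x => congr1 EFin (Im_perm_integrand A (tnth x)))).
move=> /full[iRe eRe] /full[iIm eIm].
split=> [|d T P X iidX]; apply/eqP; rewrite eq_complex /= permanentE !raddf_sum.
- apply/andP; split; apply/eqP; rewrite /Rintegral.
  + under eq_integral do rewrite Re_perm_integrand.
    by rewrite -eRe integral_fiber_sum.
  + under eq_integral do rewrite Im_perm_integrand.
    by rewrite -eIm integral_fiber_sum.
- apply/andP; split; apply/eqP; rewrite /Rintegral.
  + under eq_integral do rewrite Re_perm_integrand.
    by rewrite (expectation_fiber_sum m1 m2 iRe iidX).
  + under eq_integral do rewrite Im_perm_integrand.
    by rewrite (expectation_fiber_sum m1 m2 iIm iidX).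
Qed.
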